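(* Let $[T_1,\ldots,T_n]$ be a one-to-one power bounded $n$-tuple of operators on a Hilbert space $\mathcal H$. Then $[T_1,\ldots,T_n]$ is jointly similar to a Cuntz row isometry if and only if there exists a constant $c>0$ such that $$\sum_{|\alpha|=k}\|T_\alpha^*h\|^2\ge c\|h\|^2,\qquad h\in\mathcal H,$$ for any $k=1,2,\ldots$.
   Context: Conventions: $n\in\{1,2,\ldots\}$ or $n=\infty$; Hilbert spaces are complex, operators are bounded, infinite operator sums converge strongly. $\mathbb F_n^+$ is the free semigroup with generators $g_1,\ldots,g_n$; for $\alpha=g_{i_1}\cdots g_{i_k}$, $|\alpha|=k$ and $T_\alpha=T_{i_1}\cdots T_{i_k}$. An $n$-tuple $[T_1,\ldots,T_n]$, $T_i\in B(\mathcal H)$, is power bounded if there is a constant $M>0$ such that $\sum_{|\alpha|=k}\|T_\alpha^*h\|^2\le M^2\|h\|^2$ for all $h\in\mathcal H$ and $k=1,2,\ldots$. It is one-to-one if the row operator $\bigoplus_{i=1}^n\mathcal H\to\mathcal H$, $(h_i)\mapsto\sum_iT_ih_i$, is injective. A Cuntz row isometry is $[W_1,\ldots,W_n]$ with $W_1,\ldots,W_n$ isometries on a Hilbert space $\mathcal W$ and $\sum_iW_iW_i^*=I$. $[T_1,\ldots,T_n]$ is jointly similar to $[W_1,\ldots,W_n]$ if there is an invertible $S:\mathcal H\to\mathcal W$ with $ST_i=W_iS$ for all $i$. *)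

(* Defs.v *)
From HB Require Import structures.
From mathcomp Require Import all_boot all_order all_algebra.
From mathcomp Require Import sesquilinear complex.
From mathcomp Require Import all_classical all_reals all_analysis.

Set Implicit Arguments.
Unset Strict Implicit.
Unset Printing Implicit Defensive.

Import Order.TTheory GRing.Theory Num.Theory.
Import numFieldNormedType.Exports.

Local Open Scope classical_set_scope.
Local Open Scope complex_scope.
Local Open Scope ring_scope.

(* Complex Hilbert spaces: Banach spaces over R[i] whose norm comes from an
   inner product, linear in its first argument. *)
HB.mixin Record isHilbert (R : realType) H
    of CompleteNormedModule R[i] H := {
  hdot : {dot H for @Num.conj R[i]} ;
  hdotE : forall x : H, hdot x x = `|x| ^+ 2
}.

#[short(type="hilbertType")]
HB.structure Definition Hilbert (R : realType) :=
  {H of CompleteNormedModule R[i] H & isHilbert R H}.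

(* Library norms over R[i] take their values in R[i]. *)
Definition hnorm (R : realType) (H : hilbertType R) (x : H) : R :=
  complex.Re `|x|.

(* Number of generators: [Some m] is m, [None] is infinity. *)
Definition generator_index (n : option nat) (i : nat) : bool :=
  if n is Some m then (i < m)%N else true.

Definition generator (n : option nat) : Type := {i : nat | generator_index n i}.

HB.instance Definition _ n := Countable.on (generator n).

(* The generators whose index is smaller than [N], in order. *)
Definition generators_below (n : option nat) (N : nat) : seq (generator n) :=
  pmap insub (iota 0 N).

Section operators.
Context {R : realType}.

Definition bounded_operator (H K : hilbertType R) (A : {linear H -> K}) : Prop :=
  bounded_near A (nbhs (0 : H)).

Definition is_adjoint (H K : hilbertType R) (A : H -> K) (B : K -> H) : Prop :=
  forall x y, hdot (A x) y = hdot x (B y).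

(* Bounded operators have exactly one adjoint (Riesz); the default value of
   [xget] only matters for other functions. *)
Definition adjoint (H K : hilbertType R) (A : H -> K) : K -> H :=
  xget (fun=> 0) [set B | is_adjoint A B].

Lemma adjoint_unique (H K : hilbertType R) (A : H -> K) (B : K -> H) :
  is_adjoint A B -> adjoint A = B.
Proof.
move=> AB; rewrite /adjoint.
have : is_adjoint A (xget (fun=> 0) [set B | is_adjoint A B]).
  exact: (@xgetPex _ (fun=> 0) [set B | is_adjoint A B] (ex_intro _ B AB)).
set B' := xget _ _ => AB'; apply/funext => y; apply/eqP; rewrite -subr_eq0.
rewrite -(dnorm_eq0 hdot) linearBr/=.
by rewrite -AB -AB' subrr.
Qed.

Section tuples.
Context {n : option nat} {H : hilbertType R}.
Implicit Type T : generator n -> {linear H -> H}.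

(* T_alpha = T_{i_1} ... T_{i_k} for the word alpha = [:: i_1; ...; i_k]. *)
Definition word_op T (alpha : seq (generator n)) : H -> H :=
  foldr (fun i A => T i \o A) id alpha.

Definition words (k : nat) : set (seq (generator n)) :=
  [set alpha | size alpha = k].

Definition level_sum T (k : nat) (h : H) : \bar R :=
  \esum_(alpha in words k) (hnorm (adjoint (word_op T alpha) h) ^+ 2)%:E.

Definition power_bounded T : Prop :=
  exists2 M : R, 0 < M & forall (h : H) (k : nat), (0 < k)%N ->
    (level_sum T k h <= (M ^+ 2 * hnorm h ^+ 2)%:E)%E.

(* The Hilbert direct sum of [n] copies of [H]. *)
Definition direct_sum : set (generator n -> H) :=
  [set h | \esum_(i in setT) (hnorm (h i) ^+ 2)%:E < +oo]%E.

(* The limit exists on [direct_sum] when sum_i |T_i^* x|^2 <= M^2 |x|^2, as for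
   a power bounded tuple; elsewhere [lim] may return a default value. *)
Definition row_operator T (h : generator n -> H) : H :=
  lim ((\sum_(i <- generators_below n N) T i (h i)) @[N --> \oo]).

Definition one_to_one T : Prop := set_inj direct_sum (row_operator T).

Definition cuntz_row_isometry T : Prop :=
  [/\ forall i, bounded_operator (T i),
      forall i h, hnorm (T i h) = hnorm h &
      forall h,
        (\sum_(i <- generators_below n N) T i (adjoint (T i) h)) @[N --> \oo]
          --> h].

End tuples.

Definition jointly_similar (n : option nat) (H W : hilbertType R)
    (T : generator n -> {linear H -> H}) (V : generator n -> {linear W -> W}) :
    Prop :=
  exists (S : {linear H -> W}) (S' : {linear W -> H}),
    [/\ bounded_operator S /\ bounded_operator S', cancel S S', cancel S' S &
        forall i h, S (T i h) = V i (S h)].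

End operators.

(* Main.v *)
From HB Require Import structures.
Require Import Defs.
From mathcomp Require Import all_boot all_order all_algebra.
From mathcomp Require Import finmap sesquilinear complex ring lra.
From mathcomp Require Import all_classical all_reals all_analysis.

(** Let B_i denote the adjoint of T_i, and let the transfer operator Phi act on
    functions q on H by Phi q (h) = sum_i q (B_i h).  Splitting a word at its
    first letter shows that the level sums of T are the iterates of Phi on the
    squared norm ([level_sumS], [level_sum_transfer]).  So the two growth
    conditions say that all these iterates lie between c |h|^2 and M^2 |h|^2.

    For a Cuntz row isometry V, the relation sum_i V_i V_i^* = 1 makes the
    squared norm a fixed point of Phi, so that all level sums equal |h|^2.
    A similarity S turns the adjoint of T_w into S^* V_w^* S^{-1}^*, which costs
    only constants ([similar_cuntz_lower_bound]).

    Conversely, it is enough to find a Hilbertian squared norm q on H that is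
    equivalent to the given one and satisfies Phi q = q ([invariant_form]).
    A limit q0 of the Cesaro means of the iterates, taken along an ultrafilter
    on the integers, is bounded below by c |h|^2 and above by M^2 |h|^2.  It
    satisfies only Phi q0 <= q0 when there are infinitely many generators,
    because the ultrafilter limit does not commute with the infinite sum
    ([superinvariant_form]).  But then the iterates of Phi on q0 decrease, and
    they stay above c^2 |h|^2, because Phi^m q0 is at least c times the m-th
    iterate on the squared norm.  By monotone convergence their limit is
    a fixed point.

    Let W be H with the norm given by q, and J : W -> H the identity.  On W the
    operators D_i that coincide with B_i satisfy sum_i |D_i x|^2 = |x|^2, so
    their adjoints V_i satisfy sum_i V_i V_i^* = 1
    ([coisometry_partial_sum]).  As D_i and B_i are intertwined by J, their
    adjoints V_i and T_i are intertwined by the adjoint of J, which is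
    invertible.  So the row operator of V is injective like that of T.  It takes
    the same value at the family (V_i^* V_j w)_i and at the family whose only
    nonzero entry is w in position j; hence V_j^* V_j = 1 and the V_j are
    isometries ([injective_row_isometry], [cuntz_of_lower_bound]).

    Two classical tools are developed first: quadratic forms are handled through
    identities that are linear in the form, hence pass to sums and limits; and
    adjoints of bounded operators come from the Riesz representation theorem. *)

Set Implicit Arguments.
Unset Strict Implicit.
Unset Printing Implicit Defensive.

Import Order.TTheory GRing.Theory Num.Theory.
Import numFieldNormedType.Exports.

Local Open Scope classical_set_scope.
Local Open Scope complex_scope.
Local Open Scope ring_scope.

(** * Quadratic forms and polarization *)

Section quadratic_forms.
Context {R : realType}.

(** The functions x |-> b x x with b a Hermitian sesquilinear form; [polar]
    recovers b.  All three conditions are linear in [q] and involve finitely many of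
    its values, so they survive finite sums and pointwise limits.  The real
    homogeneity of the polar form is part of the definition, because the
    parallelogram law by itself yields only rational homogeneity. *)
Definition quadratic_form (V : lmodType R[i]) (q : V -> R) : Prop :=
  [/\ forall x y, q (x + y) + q (x - y) = 2 * (q x + q y),
      forall (t : R) x y, q (t%:C *: x + y) - q (t%:C *: x - y) =
                          t * (q (x + y) - q (x - y)) &
      forall x, q ('i *: x) = q x].

(** The real part of the polar form. *)
Definition repolar (V : lmodType R[i]) (q : V -> R) (x y : V) : R :=
  (q (x + y) - q (x - y)) / 4.

Definition polar (V : lmodType R[i]) (q : V -> R) (x y : V) : R[i] :=
  (repolar q x y) +i* (repolar q x ('i *: y)).

Lemma quadratic_form_cvg (V : lmodType R[i]) (I : Type) (F : set_system I)
    (p : I -> V -> R) (q : V -> R) : ProperFilter F ->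
  (forall i, quadratic_form (p i)) ->
  (forall x, p i x @[i --> F] --> q x) -> quadratic_form q.
Proof.
move=> FF pq cv; split=> [x y|t x y|x].
- apply: (@cvg_unique _ (@norm_hausdorff _ R^o)
    (p i (x + y) + p i (x - y) @[i --> F])).
    by apply: cvgD; exact: cv.
  rewrite (_ : (fun i => _) = (fun i => 2 * (p i x + p i y))); last first.
    by apply/funext => i; have [-> _ _] := pq i.
  by apply: cvgMr; apply: cvgD; exact: cv.
- apply: (@cvg_unique _ (@norm_hausdorff _ R^o)
    (p i (t%:C *: x + y) - p i (t%:C *: x - y) @[i --> F])).
    by apply: cvgB; exact: cv.
  rewrite (_ : (fun i => _) = (fun i => t * (p i (x + y) - p i (x - y))));
    last first.
    by apply/funext => i; have [_ -> _] := pq i.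
  by apply: cvgMr; apply: cvgB; exact: cv.
- apply: (@cvg_unique _ (@norm_hausdorff _ R^o) (p i ('i *: x) @[i --> F])).
    exact: cv.
  rewrite (_ : (fun i => _) = (fun i => p i x)); last first.
    by apply/funext => i; have [_ _ ->] := pq i.
  exact: cv.
Qed.

Lemma quadratic_form0 (V : lmodType R[i]) : quadratic_form (fun _ : V => 0 : R).
Proof. by split=> *; ring. Qed.

Lemma quadratic_formD (V : lmodType R[i]) (p q : V -> R) :
  quadratic_form p -> quadratic_form q -> quadratic_form (fun x => p x + q x).
Proof.
move=> [p1 p2 p3] [q1 q2 q3]; split=> [x y|t x y|x].
- by have := p1 x y; have := q1 x y; lra.
- have := p2 t x y; have := q2 t x y => h1 h2.
  transitivity (t * (p (x + y) - p (x - y)) + t * (q (x + y) - q (x - y))).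
    by rewrite -h1 -h2; ring.
  by ring.
- by rewrite p3 q3.
Qed.

Lemma quadratic_formZ (V : lmodType R[i]) (a : R) (q : V -> R) :
  quadratic_form q -> quadratic_form (fun x => a * q x).
Proof.
move=> [q1 q2 q3]; split=> [x y|t x y|x].
- by rewrite -mulrDr q1; ring.
- by rewrite -mulrBr q2; ring.
- by rewrite q3.
Qed.

Lemma quadratic_form_sum (V : lmodType R[i]) (I : Type) (r : seq I)
    (p : I -> V -> R) : (forall i, quadratic_form (p i)) ->
  quadratic_form (fun x => \sum_(i <- r) p i x).
Proof.
move=> pq; elim: r => [|i r IH].
  rewrite (_ : (fun x => _) = fun=> 0); first exact: quadratic_form0.
  by apply/funext => x; rewrite big_nil.
rewrite (_ : (fun x => _) = (fun x => p i x + \sum_(j <- r) p j x)).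
  exact: quadratic_formD.
by apply/funext => x; rewrite big_cons.
Qed.

Lemma quadratic_form_comp (V W : lmodType R[i]) (A : {linear V -> W})
    (q : W -> R) :
  quadratic_form q -> quadratic_form (q \o A).
Proof.
move=> [q1 q2 q3]; split=> [x y|t x y|x] /=.
- by rewrite linearD linearB q1.
- by rewrite linearD linearB !linearZ q2 linearD linearB.
- by rewrite linearZ q3.
Qed.

Section polarization.
Context {V : lmodType R[i]} {q : V -> R}.
Hypothesis qq : quadratic_form q.
Implicit Types x y z : V.

Lemma iMi x : 'i *: ('i *: x) = - x.
Proof. by rewrite scalerA -expr2 sqr_i scaleN1r. Qed.

Lemma quadratic_formN x : q (- x) = q x.
Proof. by have [_ _ qi] := qq; rewrite -iMi !qi. Qed.

Lemma quadratic_form_at0 : q 0 = 0.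
Proof. by have [q1 _ _] := qq; have := q1 0 0; rewrite addr0 subr0; lra. Qed.

Lemma repolarC x y : repolar q x y = repolar q y x.
Proof. by rewrite /repolar [y + x]addrC -(quadratic_formN (x - y)) opprB. Qed.

Lemma repolar0l y : repolar q 0 y = 0.
Proof. by rewrite /repolar add0r sub0r quadratic_formN subrr mul0r. Qed.

(** The parallelogram law for the pairs (x + y, x' + y) and (x - y, x' - y) has
    a common term that cancels, which leaves half the polar form at
    (x + x', 2 y); the case x' = 0 removes the factor. *)
Lemma repolarDl x x' y : repolar q (x + x') y = repolar q x y + repolar q x' y.
Proof.
have [q1 _ _] := qq.
have half u u' :
    repolar q u y + repolar q u' y = repolar q (u + u') (y + y) / 2.
  have := q1 (u + y) (u' + y); have := q1 (u - y) (u' - y).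
  have -> : u - y + (u' - y) = u + u' - (y + y) by rewrite addrACA -opprD.
  have -> : u - y - (u' - y) = u - u' by rewrite opprB addrA subrK.
  have -> : u + y + (u' + y) = u + u' + (y + y) by rewrite addrACA.
  have -> : u + y - (u' + y) = u - u' by rewrite opprD addrACA subrr addr0.
  by rewrite /repolar; lra.
have := half x x'; have := half (x + x') 0.
by rewrite repolar0l !addr0 => -> ->.
Qed.

Lemma repolarZl (t : R) x y : repolar q (t%:C *: x) y = t * repolar q x y.
Proof. by have [_ q2 _] := qq; rewrite /repolar q2 mulrA. Qed.

Lemma repolarZr (t : R) x y : repolar q x (t%:C *: y) = t * repolar q x y.
Proof. by rewrite repolarC repolarZl repolarC. Qed.

Lemma repolarNr x y : repolar q x (- y) = - repolar q x y.
Proof. by rewrite /repolar opprK; lra. Qed.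

(** Multiplication by 'i preserves [q] and carries x - 'i y to 'i x + y. *)
Lemma repolar_iMl x y : repolar q ('i *: x) y = - repolar q x ('i *: y).
Proof.
have [_ _ qi] := qq; rewrite /repolar -(qi (x + _)) -(qi (x - _)).
by rewrite scalerDr scalerBr iMi opprK; lra.
Qed.

Lemma repolarxx x : repolar q x x = q x.
Proof.
have [q1 _ _] := qq; have := q1 x x.
by rewrite /repolar subrr quadratic_form_at0; lra.
Qed.

Lemma quadratic_formDE x y : q (x + y) = q x + 2 * repolar q x y + q y.
Proof. by have [q1 _ _] := qq; have := q1 x y; rewrite /repolar; lra. Qed.

Lemma polar_linearl y : linear ((polar q)^~ y).
Proof.
move=> a u v; case: a => r s; rewrite /polar.
have -> : (r +i* s) *: u = r%:C *: u + s%:C *: ('i *: u).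
  rewrite scalerA -scalerDl; congr (_ *: _).
  by apply/eqP; rewrite eq_complex /=; apply/andP; split; apply/eqP; ring.
rewrite !repolarDl !repolarZl !repolar_iMl iMi repolarNr.
by apply/eqP; rewrite eq_complex /=; apply/andP; split; apply/eqP; ring.
Qed.

Lemma polarC x y : polar q x y = (polar q y x)^*%C.
Proof.
by rewrite /polar /= -repolar_iMl (repolarC y x) (repolarC ('i *: y)).
Qed.

Lemma polarxx x : polar q x x = (q x)%:C.
Proof.
rewrite /polar repolarxx; congr (_ +i* _).
by have := repolar_iMl x x; rewrite repolarC; lra.
Qed.

Hypothesis q_ge0 : forall x, 0 <= q x.

(** Cauchy-Schwarz, by expanding [q] at a real combination of x and y whose
    coefficients are the square roots of q y and q x; when one of these vanishes
    the combination can be made arbitrarily lopsided instead. *)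
Lemma repolar_le x y : repolar q x y <= Num.sqrt (q x) * Num.sqrt (q y).
Proof.
have sq z : Num.sqrt (q z) ^+ 2 = q z by rewrite sqr_sqrtr.
have CS s t : 2 * s * t * repolar q x y <= s ^+ 2 * q x + t ^+ 2 * q y.
  have := q_ge0 (s%:C *: x + (- t)%:C *: y).
  rewrite quadratic_formDE repolarZl repolarZr.
  rewrite -[q (_ *: x)]repolarxx -[q (_ *: y)]repolarxx.
  by rewrite !repolarZl !repolarZr !repolarxx; lra.
have rxy0 : 2 * (q x * q y) == 0 -> repolar q x y <= 0.
  rewrite mulf_eq0 pnatr_eq0/= mulf_eq0 => xy0; rewrite leNgt; apply/negP => p0.
  have fr a : 2 * (a / (2 * repolar q x y)) * repolar q x y = a.
    by field; rewrite gt_eqF.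
  have [/eqP x0|/eqP y0] := orP xy0.
    have := CS ((q y + 1) / (2 * repolar q x y)) 1.
    by rewrite x0 mulr1 fr; lra.
  have := CS 1 ((q x + 1) / (2 * repolar q x y)).
  by rewrite y0 mulr1 fr; lra.
have [/rxy0 h|n0] := boolP (2 * (q x * q y) == 0).
  by rewrite (le_trans h)// mulr_ge0 ?sqrtr_ge0.
have : 0 < Num.sqrt (q x) * Num.sqrt (q y).
  move: n0; rewrite mulf_eq0 pnatr_eq0/= mulf_eq0 negb_or => /andP[x0 y0].
  by rewrite mulr_gt0// sqrtr_gt0 lt_def ?x0 ?y0 q_ge0.
move=> p; rewrite -(ler_pM2l p).
rewrite -[leRHS]expr2 exprMn !sq.
by have := CS (Num.sqrt (q y)) (Num.sqrt (q x)); rewrite !sq; lra.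
Qed.

End polarization.

End quadratic_forms.

(** * Hilbert spaces through the real part of the inner product *)

Section hilbert.
Context {R : realType}.

Lemma ReD (a b : R[i]) : complex.Re (a + b) = complex.Re a + complex.Re b.
Proof. by case: a; case: b. Qed.

Lemma ReN (a : R[i]) : complex.Re (- a) = - complex.Re a.
Proof. by case: a. Qed.

Lemma ReZ (t : R) (a : R[i]) : complex.Re (t%:C * a) = t * complex.Re a.
Proof. by case: a => a b; rewrite /= mul0r subr0. Qed.

Lemma ReiM (a : R[i]) : complex.Re ('i * a) = - complex.Im a.
Proof. by case: a => a b; rewrite /= mul0r mul1r sub0r. Qed.

(** The real part of the inner product determines the inner product, and it
    takes its values in an ordered field. *)
Definition ip (H : hilbertType R) (x y : H) : R := complex.Re (hdot x y).

Section one_space.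
Variable H : hilbertType R.
Implicit Types (x y z : H) (t : R).

Lemma norm_hnormE x : `|x| = (hnorm x)%:C.
Proof. by rewrite /hnorm RRe_real// ger0_real. Qed.

Lemma hnorm_ge0 x : 0 <= hnorm x.
Proof. by rewrite -ler0c -norm_hnormE. Qed.

Lemma ipxx x : ip x x = hnorm x ^+ 2.
Proof. by rewrite /ip hdotE norm_hnormE -rmorphXn. Qed.

Lemma hnorm0 : hnorm (0 : H) = 0.
Proof. by apply: complexI; rewrite -norm_hnormE normr0. Qed.

Lemma hnorm_eq0 x : hnorm x = 0 -> x = 0.
Proof. by move=> x0; apply: normr0_eq0; rewrite norm_hnormE x0. Qed.

Lemma hnorm_opp x : hnorm (- x) = hnorm x.
Proof. by apply: complexI; rewrite -!norm_hnormE normrN. Qed.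

Lemma hnorm_distC x y : hnorm (x - y) = hnorm (y - x).
Proof. by rewrite -opprB hnorm_opp. Qed.

Lemma hnormZ t x : hnorm (t%:C *: x) = `|t| * hnorm x.
Proof.
apply: complexI; rewrite rmorphM/= -!norm_hnormE normrZ; congr (_ * _).
by rewrite normc_def /= expr0n addr0 sqrtr_sqr.
Qed.

Lemma hnormZi x : hnorm ('i *: x) = hnorm x.
Proof.
apply: complexI; rewrite -!norm_hnormE normrZ normc_def /= expr0n add0r.
by rewrite expr1n sqrtr1 mul1r.
Qed.

Lemma hdotC x y : hdot y x = (hdot x y)^*.
Proof. by have := hermC hdot y x; rewrite expr0 mul1r. Qed.

Lemma ipC x y : ip x y = ip y x.
Proof. by rewrite /ip [in RHS]hdotC; case: (hdot x y). Qed.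

Lemma ipDl x y z : ip (x + y) z = ip x z + ip y z.
Proof. by rewrite /ip linearDl ReD. Qed.

Lemma ipNl x z : ip (- x) z = - ip x z.
Proof. by rewrite /ip linearNl ReN. Qed.

Lemma ipBl x y z : ip (x - y) z = ip x z - ip y z.
Proof. by rewrite ipDl ipNl. Qed.

Lemma ipZl t x z : ip (t%:C *: x) z = t * ip x z.
Proof. by rewrite /ip linearZl_LR/= ReZ. Qed.

Lemma ipDr x y z : ip z (x + y) = ip z x + ip z y.
Proof. by rewrite ipC ipDl !(ipC z). Qed.

Lemma ipNr x z : ip z (- x) = - ip z x.
Proof. by rewrite ipC ipNl (ipC z). Qed.

Lemma ipBr x y z : ip z (x - y) = ip z x - ip z y.
Proof. by rewrite ipC ipBl !(ipC z). Qed.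

Lemma ipZr t x z : ip z (t%:C *: x) = t * ip z x.
Proof. by rewrite ipC ipZl (ipC z). Qed.

Lemma ip_sumr (I : Type) (r : seq I) (F : I -> H) z :
  ip z (\sum_(i <- r) F i) = \sum_(i <- r) ip z (F i).
Proof.
by apply: (big_morph (ip z)) => [x y|]; rewrite ?ipDr// /ip linear0r.
Qed.

Lemma ip_Im x y : complex.Im (hdot x y) = - ip ('i *: x) y.
Proof. by rewrite /ip linearZl_LR/= ReiM opprK. Qed.

Lemma hnormD2 x y :
  hnorm (x + y) ^+ 2 = hnorm x ^+ 2 + 2 * ip x y + hnorm y ^+ 2.
Proof. by rewrite -!ipxx ipDl !ipDr (ipC y x); ring. Qed.

Lemma hnormB2 x y :
  hnorm (x - y) ^+ 2 = hnorm x ^+ 2 - 2 * ip x y + hnorm y ^+ 2.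
Proof. by rewrite hnormD2 ipNr hnorm_opp; ring. Qed.

Lemma quadratic_form_hnorm : quadratic_form (fun x : H => hnorm x ^+ 2).
Proof.
split=> [x y|t x y|x]; last by rewrite hnormZi.
- by rewrite hnormD2 hnormB2; ring.
- by rewrite !hnormD2 !ipNr !hnorm_opp ipZl; ring.
Qed.

Lemma repolar_hnorm x y : repolar (fun x : H => hnorm x ^+ 2) x y = ip x y.
Proof. by rewrite /repolar /= !hnormD2 ipNr hnorm_opp; lra. Qed.

Lemma ip_le x y : ip x y <= hnorm x * hnorm y.
Proof.
rewrite -repolar_hnorm.
rewrite (le_trans (repolar_le quadratic_form_hnorm _ _ _)) => [|z|]//=.
  exact: sqr_ge0.
by rewrite !sqrtr_sqr !ger0_norm ?hnorm_ge0.
Qed.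

Lemma normr_ip_le x y : `|ip x y| <= hnorm x * hnorm y.
Proof. by rewrite ler_norml lerNl -ipNr ip_le -(hnorm_opp y) ip_le. Qed.

Lemma ip_inj y z : (forall x, ip x y = ip x z) -> y = z.
Proof.
move=> E; apply/eqP; rewrite -subr_eq0; apply/eqP/hnorm_eq0/eqP.
by rewrite -sqrf_eq0 -ipxx ipBr E subrr.
Qed.

Lemma hdot_inj y z : (forall x, hdot x y = hdot x z) -> y = z.
Proof. by move=> E; apply: ip_inj => x; rewrite /ip E. Qed.

Lemma cvg_hnormP (T : Type) (F : set_system T) (FF : Filter F)
    (u : T -> H) (l : H) :
  u @ F --> l <-> (forall e, 0 < e -> \forall n \near F, hnorm (l - u n) < e).
Proof.
split=> [/cvgrPdist_lt ul e e0|ul].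
  have /ul : 0 < e%:C by rewrite (ltcR 0).
  by apply: filterS => n; rewrite norm_hnormE ltcR.
apply/cvgrPdist_lt => -[a b]; rewrite ltcE/= => /andP[/eqP -> a0].
by have := ul _ a0; apply: filterS => n; rewrite norm_hnormE -ltcR.
Qed.

Lemma complete_seq (u : nat -> H) :
  (forall e, 0 < e -> exists N, forall m n, (N <= m)%N -> (N <= n)%N ->
    hnorm (u m - u n) < e) -> exists l : H, u n @[n --> \oo] --> l.
Proof.
move=> cu; suff /cauchy_cvgP cv : cauchy (u @ \oo).
  by exists (lim (u @ \oo)); exact: cv.
apply/cauchy_exP => -[a b]; rewrite ltcE/= => /andP[/eqP -> a0].
have [N uN] := cu _ a0; exists (u N); exists N => // m /= Nm.
by rewrite -ball_normE /= norm_hnormE -/(a%:C) ltcR uN.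
Qed.

End one_space.

(** The imaginary part of <x, y> is minus the real part of <'i x, y>. *)
Lemma ip_hdot (H K : hilbertType R) (x y : H) (x' y' : K) :
  (forall a : R[i], ip (a *: x) y = ip (a *: x') y') -> hdot x y = hdot x' y'.
Proof.
move=> E; apply/eqP; rewrite eq_complex; apply/andP; split; apply/eqP.
  by have := E 1; rewrite !scale1r.
by rewrite !ip_Im E.
Qed.

Lemma bounded_operatorP (H K : hilbertType R) (A : {linear H -> K}) :
  bounded_operator A <->
  exists2 C, 0 < C & forall x, hnorm (A x) <= C * hnorm x.
Proof.
split=> [/linear_boundedP/pinfty_ex_gt0 [[C d]]|[C C0 AC]].
  rewrite ltcE/= => /andP[/eqP -> C0] AC; exists C => // x.
  by rewrite -lecR rmorphM /= -!norm_hnormE AC.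
apply/linear_boundedP; near=> r => x.
apply: (@le_trans _ _ (C%:C * `|x|)).
  by rewrite !norm_hnormE -rmorphM/= lecR.
apply: ler_wpM2r => //; near: r; apply: nbhs_pinfty_ge.
by apply/ger0_real; rewrite ler0c ltW.
Unshelve. all: by end_near. Qed.

End hilbert.

(** * The Riesz representation theorem and adjoints *)

Section riesz.
Context {R : realType}.

Lemma quad_ge0_eq0 (a d : R) : 0 <= a ->
  (forall t, 0 <= 2 * t * d + t ^+ 2 * a) -> d = 0.
Proof.
move=> a0 h; have a1 : 0 < a + 1 by rewrite ltr_wpDl.
apply/eqP; rewrite -sqrf_eq0 eq_le sqr_ge0 andbT.
have := h (- (d / (a + 1))).
have -> : 2 * - (d / (a + 1)) * d + (- (d / (a + 1))) ^+ 2 * a =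
  (- d ^+ 2 * (a + 2)) / (a + 1) ^+ 2 by field; rewrite gt_eqF.
rewrite pmulr_lge0 ?invr_gt0 ?exprn_gt0// mulNr oppr_ge0.
by rewrite pmulr_lle0// ltr_wpDl.
Qed.

(** The functional J x = |x|^2 - 2 g x is bounded below, and by the parallelogram
    law every minimizing sequence is Cauchy.  At its limit y the derivative of J
    in every direction z vanishes, that is, <z, y> = g z.  The derivative is
    tested on the minimizing sequence itself, up to an arbitrarily small error,
    which avoids proving that J is continuous. *)
Lemma riesz (H : hilbertType R) (g : H -> R) (C : R) :
  {morph g : x y / x + y} -> (forall t x, g (t%:C *: x) = t * g x) ->
  (forall x, g x <= C * hnorm x) -> exists y, forall x, g x = ip x y.
Proof.
move=> gD gZ gC.
pose J x := hnorm x ^+ 2 - 2 * g x; pose m := inf (range J).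
have Jlb : has_inf (range J).
  split; first by exists (J 0), 0.
  exists (- C ^+ 2) => _ [x _ <-]; rewrite /J.
  by have := gC x; have := sqr_ge0 (hnorm x - C); nra.
have mJ x : m <= J x by apply: ge_inf; [exact: Jlb.2|exists x].
have JD x z (t : R) : J (x + t%:C *: z) =
    J x + 2 * t * (ip z x - g z) + t ^+ 2 * hnorm z ^+ 2.
  rewrite /J hnormD2 gD gZ hnormZ ipZr ipC exprMn -normrX.
  by rewrite ger0_norm ?sqr_ge0//; ring.
have gN x : g (- x) = - g x.
  by have := gZ (-1) x; rewrite rmorphN1 scaleN1r mulN1r.
have near_min x y : hnorm (x - y) ^+ 2 <= 2 * (J x - m) + 2 * (J y - m).
  have := mJ (x + (2^-1)%:C *: (y - x)); rewrite JD.
  by rewrite !hnormB2 ipBl gD gN ipxx (ipC y) /J; lra.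
have /choice[x xJ] : forall k, exists x, J x < m + k.+1%:R^-1.
  move=> k; have [|_ [x _ <-]] := @inf_adherent _ (range J) k.+1%:R^-1 _ Jlb.
    by rewrite invr_gt0.
  by exists x.
have [y xy] : exists y : H, x n @[n --> \oo] --> y.
  apply: complete_seq => e e0.
  have e4 : 0 < e ^+ 2 / 4 by rewrite divr_gt0// exprn_gt0.
  have [N _ NP] := near_infty_natSinv_lt (PosNum e4).
  exists N => p q Np Nq.
  rewrite -(@ltr_pXn2r _ 2%N)// ?nnegrE ?hnorm_ge0 ?ltW//.
  apply: (le_lt_trans (near_min _ _)).
  have := NP _ Np; have := NP _ Nq; have := xJ p; have := xJ q => /=.
  by move: (J (x p)) (J (x q)) p.+1%:R^-1 q.+1%:R^-1; clear; move=> *; lra.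
exists y => z; apply/esym/eqP; rewrite -subr_eq0; apply/eqP.
apply: (@quad_ge0_eq0 (hnorm z ^+ 2)) => [|t]; first exact: sqr_ge0.
apply/ler_addgt0Pr => e e0.
have n0 := hnorm_ge0 z; have t0 := normr_ge0 t.
(* Replacing y by x k changes the linear term by at most
   2 |t| |z| |y - x k|, and the infimum m by at most (k + 1)^-1; each of the two
   errors is made at most e / 2. *)
pose s := 2 * `|t| * hnorm z + 1.
have s0 : 0 < s by rewrite ltr_wpDl// !mulr_ge0.
have d0 : 0 < e / 2 / s by rewrite !divr_gt0.
have e2 : 0 < e / 2 by rewrite divr_gt0.
have /cvg_hnormP/(_ _ d0) xyd := xy.
near \oo => k.
have k1 : hnorm (y - x k) < e / 2 / s by near: k.
have k2 : k.+1%:R^-1 < e / 2.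
  by near: k; exact: (near_infty_natSinv_lt (PosNum e2)).
have := mJ (x k + t%:C *: z); rewrite JD.
have := xJ k.
have : t * (ip z (x k) - ip z y) <= `|t| * (hnorm z * hnorm (y - x k)).
  apply: le_trans (ler_norm _) _; rewrite normrM ler_wpM2l// -ipBr hnorm_distC.
  exact: normr_ip_le.
have : `|t| * (hnorm z * hnorm (y - x k)) * 2 <= e / 2.
  move: k1; rewrite ltr_pdivlMr// => /ltW; apply: le_trans.
  by rewrite /s mulrDr mulr1; have := hnorm_ge0 (y - x k); lra.
move: k2; clear.
move: (e : R) (m : R) (J _ : R) (ip z _) (ip z y) (g z) (hnorm z) (hnorm _).
by move: (`|t|) k.+1%:R^-1 => *; nra.
Unshelve. all: by end_near. Qed.

Lemma adjoint_ex (H K : hilbertType R) (A : {linear H -> K}) :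
  bounded_operator A ->
  exists2 B : {linear K -> H}, is_adjoint A B & bounded_operator B.
Proof.
move=> /bounded_operatorP[C C0 AC].
have /choice[B AB] : forall y, exists z, forall x, ip (A x) y = ip x z.
  move=> y; apply: (@riesz H (fun x => ip (A x) y) (C * hnorm y)).
  - by move=> x x'; rewrite linearD ipDl.
  - by move=> t x; rewrite linearZ ipZl.
  - move=> x; apply: le_trans (ip_le _ _) _.
    by rewrite mulrAC ler_wpM2r// hnorm_ge0.
have adjB : is_adjoint A B.
  by move=> x y; apply: ip_hdot => a; rewrite -AB linearZ.
have linB : linear B.
  move=> a u v; apply: hdot_inj => x.
  by rewrite -adjB !linearDr !linearZr_LR/= -!adjB.
pose B' : {linear K -> H} := HB.pack B (GRing.isLinear.Build _ _ _ _ B linB).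
exists B' => //; apply/bounded_operatorP; exists C => // y.
have [->|] := eqVneq (hnorm (B y)) 0; first by rewrite mulr_ge0 ?hnorm_ge0 ?ltW.
move=> n0; have np : 0 < hnorm (B y) by rewrite lt_def n0 hnorm_ge0.
rewrite -(ler_pM2l np) -expr2 -ipxx -AB (le_trans (ip_le _ _))//.
by rewrite mulrA (mulrC (hnorm (B y))) ler_wpM2r ?hnorm_ge0.
Qed.

Lemma is_adjoint_sym (H K : hilbertType R) (A : H -> K) (B : K -> H) :
  is_adjoint A B -> is_adjoint B A.
Proof. by move=> AB x y; rewrite hdotC -AB -hdotC. Qed.

Lemma is_adjoint_comp (H K L : hilbertType R) (A : H -> K) (A' : K -> H)
    (B : K -> L) (B' : L -> K) :
  is_adjoint A A' -> is_adjoint B B' -> is_adjoint (B \o A) (A' \o B').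
Proof. by move=> AA BB x y; rewrite /= BB AA. Qed.

Lemma adjointP (H K : hilbertType R) (A : {linear H -> K}) :
  bounded_operator A -> is_adjoint A (adjoint A).
Proof. by move=> /adjoint_ex[B AB _]; rewrite (adjoint_unique AB). Qed.

End riesz.

(** * Hilbert spaces with an equivalent norm *)

Section renorming.
Context {R : realType}.

Record equivalent_form (H : hilbertType R) := EquivalentForm {
  eqform :> H -> R;
  eqform_quadratic : quadratic_form eqform;
  eqform_lower : exists2 c, 0 < c & forall x, c * hnorm x ^+ 2 <= eqform x;
  eqform_upper : exists2 C, 0 < C & forall x, eqform x <= C * hnorm x ^+ 2 }.

(** A copy of H that carries no topology of its own, so that it can receive the
    norm given by [q]. *)
Definition renormed (H : hilbertType R) (q : equivalent_form H) : Type := H.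

Section renormed.
Variables (H : hilbertType R) (q : equivalent_form H).
Local Notation Hq := (renormed q).

HB.instance Definition _ := GRing.Lmodule.on Hq.

Let q_ge0 x : 0 <= q x.
Proof.
have [c c0 cq] := eqform_lower q.
by apply: le_trans (cq x); rewrite mulr_ge0 ?sqr_ge0 ?ltW.
Qed.

Let q_eq0 x : q x = 0 -> x = 0.
Proof.
have [c c0 cq] := eqform_lower q => qx; have := cq x; rewrite qx.
rewrite pmulr_rle0// => h; apply: hnorm_eq0; apply/eqP.
by rewrite -sqrf_eq0 eq_le h sqr_ge0.
Qed.

Definition renorm (x : Hq) : R[i] := (Num.sqrt (q x))%:C.

Lemma renormD x y : renorm (x + y) <= renorm x + renorm y.
Proof.
rewrite /renorm -rmorphD/= lecR.
rewrite -(@ler_pXn2r _ 2%N)// ?nnegrE ?addr_ge0 ?sqrtr_ge0//.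
rewrite sqrrD !sqr_sqrtr// (quadratic_formDE (eqform_quadratic q)).
have := repolar_le (eqform_quadratic q) q_ge0 x y.
by rewrite -mulr_natl; lra.
Qed.

Lemma renormZ a (x : Hq) : renorm (a *: x) = `|a| * renorm x.
Proof.
rewrite /renorm normc_def -rmorphM/= -sqrtrM ?addr_ge0 ?sqr_ge0//.
congr ((Num.sqrt _)%:C); case: a => r s /=.
have qq := eqform_quadratic q.
have -> : (r +i* s) *: x = r%:C *: x + s%:C *: ('i *: x) :> Hq.
  rewrite scalerA -scalerDl; congr (_ *: _).
  by apply/eqP; rewrite eq_complex /=; apply/andP; split; apply/eqP; ring.
rewrite -(repolarxx qq) !(repolarDl qq) !(repolarZl qq).
rewrite !(repolarC qq _ (_ + _)).
rewrite !(repolarDl qq) !(repolarZl qq) !(repolarxx qq).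
have [_ _ ->] := qq.
have := repolar_iMl qq x x; rewrite (repolarC qq x) => e.
have -> : repolar q ('i *: x) x = 0 by lra.
by ring.
Qed.

Lemma renorm_eq0 x : renorm x = 0 -> x = 0.
Proof.
move=> /complexI/eqP; rewrite sqrtr_eq0 => h.
by apply: q_eq0; apply/eqP; rewrite eq_le h q_ge0.
Qed.

HB.instance Definition _ := Lmodule_isNormed.Build R[i] Hq
  renormD renormZ renorm_eq0.

Lemma renormed_normE (x : Hq) : `|x| = (Num.sqrt (q x))%:C.
Proof. by []. Qed.

(** Balls of the two norms contain each other up to a constant radius, so the
    Cauchy filters and the limits are the same for both norms. *)
Lemma renormed_complete (F : set_system Hq) :
  ProperFilter F -> cauchy F -> cvg F.
Proof.
have [c c0 cq] := eqform_lower q; have [C C0 Cq] := eqform_upper q.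
move=> FF cF.
pose G : set_system H := F.
have FG : ProperFilter G by [].
have cG : cauchy G.
  apply/cauchyP => -[a b]; rewrite ltcE/= => /andP[/eqP -> a0].
  have d0 : 0 < (Num.sqrt c * a)%:C by rewrite (ltcR 0) mulr_gt0// sqrtr_gt0.
  have /cauchyP/(_ _ d0)[x xF] := cF; exists x; apply: filterS xF => y.
  rewrite -!ball_normE /= renormed_normE ltcR -/(a%:C) norm_hnormE ltcR => h.
  have sc0 : 0 < Num.sqrt c by rewrite sqrtr_gt0.
  rewrite -(ltr_pM2l sc0); apply: (le_lt_trans _ h).
  rewrite -[leLHS]ger0_norm; last first.
    by rewrite mulr_ge0 ?hnorm_ge0 ?ltW.
  by rewrite -sqrtr_sqr exprMn sqr_sqrtr ?(ltW c0)//; apply: ler_wsqrtr.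
have /cauchy_cvgP/cvg_ex[l Gl] := cG.
apply/cvg_ex; exists (l : Hq).
apply/fcvgrPdist_lt => -[a b]; rewrite ltcE/= => /andP[/eqP -> a0].
have sC0 : 0 < Num.sqrt C by rewrite sqrtr_gt0.
have d0 : 0 < (a / Num.sqrt C)%:C by rewrite (ltcR 0) divr_gt0.
have /fcvgrPdist_lt/(_ _ d0) Gd := Gl; apply: filterS Gd => y.
rewrite norm_hnormE ltcR renormed_normE -/(a%:C) ltcR ltr_pdivlMr// mulrC.
apply: le_lt_trans; rewrite -[leRHS]ger0_norm; last first.
  by rewrite mulr_ge0 ?hnorm_ge0 ?ltW.
by rewrite -sqrtr_sqr exprMn sqr_sqrtr ?(ltW C0)//; apply: ler_wsqrtr.
Qed.

HB.instance Definition _ := Uniform_isComplete.Build Hq renormed_complete.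

Definition renormed_dot (x y : Hq) : R[i] := polar q x y.

Lemma renormed_dot_bilinear : bilinear_for *%R (Num.conj \; *%R) renormed_dot.
Proof.
split=> [y a u v|x a u v].
  exact: (polar_linearl (eqform_quadratic q)).
rewrite /renormed_dot !(polarC (eqform_quadratic q) x).
by rewrite (polar_linearl (eqform_quadratic q)) rmorphD rmorphM.
Qed.

HB.instance Definition _ := bilinear_isBilinear.Build R[i] Hq Hq R[i]
  *%R (Num.conj \; *%R) renormed_dot renormed_dot_bilinear.

Lemma renormed_dot_herm (x y : Hq) :
  renormed_dot x y = (-1) ^+ false * Num.conj (renormed_dot y x).
Proof. by rewrite expr0 mul1r /renormed_dot (polarC (eqform_quadratic q)). Qed.

HB.instance Definition _ := isHermitianSesquilinear.Build R[i] Hq false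
   Num.conj renormed_dot renormed_dot_herm.

Lemma renormed_dot_gt0 (u : Hq) : u != 0 -> 0 < renormed_dot u u.
Proof.
move=> u0; rewrite /renormed_dot (polarxx (eqform_quadratic q)) (ltcR 0).
rewrite lt_def q_ge0 andbT; apply: contra_neq u0; exact: q_eq0.
Qed.

HB.instance Definition _ :=
  isDotProduct.Build R[i] Hq renormed_dot renormed_dot_gt0.

Lemma renormed_hdotE (x : Hq) : renormed_dot x x = `|x| ^+ 2.
Proof.
rewrite renormed_normE -rmorphXn/= sqr_sqrtr//.
exact: (polarxx (eqform_quadratic q)).
Qed.

HB.instance Definition _ := isHilbert.Build R Hq renormed_hdotE.

Lemma renormed_hnorm2 (x : Hq) : hnorm x ^+ 2 = q x.
Proof.
by rewrite /hnorm renormed_normE /= sqr_sqrtr.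
Qed.

End renormed.

End renorming.

(** * Sums over the generators *)

Section generator_sums.
Context {R : realType} {n : option nat}.
Implicit Types (f g : generator n -> R) (N : nat) (S : R).

Lemma generators_belowD N k :
  generators_below n (N + k) =
  generators_below n N ++ pmap insub (iota N k).
Proof. by rewrite /generators_below iotaD pmap_cat. Qed.

Lemma generators_below_uniq N : uniq (generators_below n N).
Proof. exact/pmap_sub_uniq/iota_uniq. Qed.

Lemma mem_generators_below N (i : generator n) :
  (i \in generators_below n N) = (val i < N)%N.
Proof. by rewrite mem_pmap_sub mem_iota. Qed.

Definition gen_sum f : R :=
  sup (range (fun N => \sum_(i <- generators_below n N) f i)).

Lemma partial_gen_sum_homo f : (forall i, 0 <= f i) ->
  {homo (fun N => \sum_(i <- generators_below n N) f i) :
    N N' / (N <= N')%N >-> N <= N'}.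
Proof.
move=> f0 N N' /subnKC <-; rewrite generators_belowD big_cat/= lerDl.
exact: sumr_ge0.
Qed.

Lemma gen_sum_cvg f S : (forall i, 0 <= f i) ->
  (forall N, \sum_(i <- generators_below n N) f i <= S) ->
  \sum_(i <- generators_below n N) f i @[N --> \oo] --> gen_sum f.
Proof.
move=> f0 fS; apply: nondecreasing_cvgn; first exact: partial_gen_sum_homo.
by exists S => _ [N _ <-].
Qed.

Lemma partial_gen_sum_le_lim f S : (forall i, 0 <= f i) ->
  \sum_(i <- generators_below n N) f i @[N --> \oo] --> S ->
  forall N, \sum_(i <- generators_below n N) f i <= S.
Proof.
move=> f0 fS N; rewrite -(cvg_lim _ fS)//.
apply: nondecreasing_cvgn_le; first exact: partial_gen_sum_homo.
by apply/cvg_ex; exists S.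
Qed.

Lemma lim_le_bound (u : nat -> R) l S : u N @[N --> \oo] --> l ->
  (forall N, u N <= S) -> l <= S.
Proof.
move=> ul uS; rewrite -(cvg_lim _ ul)//; apply: limr_le; last exact: nearW.
by apply/cvg_ex; exists l.
Qed.

Lemma partial_le_esum f N : (forall i, 0 <= f i) ->
  ((\sum_(i <- generators_below n N) f i)%:E <= \esum_(i in setT) (f i)%:E)%E.
Proof.
move=> f0; apply: esum_ge; exists [set` generators_below n N].
  by split => //; exact: finite_seq.
by rewrite -fsbig_seq ?generators_below_uniq// sumEFin.
Qed.

Lemma esum_le_bound f S : (forall i, 0 <= f i) ->
  (forall N, \sum_(i <- generators_below n N) f i <= S) ->
  (\esum_(i in setT) (f i)%:E <= S%:E)%E.
Proof.
move=> f0 fS; apply: ge_ereal_sup => _ [X [finX _] <-].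
rewrite fsbig_finite//= sumEFin lee_fin.
pose r : seq (generator n) := fset_set X; rewrite -/r.
pose N := (\max_(i <- r) val i).+1.
apply: le_trans (fS N); rewrite [leRHS](bigID (mem r))/=.
rewrite (_ : \sum_(i <- generators_below n N | i \in r) f i =
   \sum_(i <- r) f i); first by rewrite lerDl sumr_ge0.
rewrite -big_filter; apply: perm_big; apply: uniq_perm.
- exact/filter_uniq/generators_below_uniq.
- exact: fset_uniq.
move=> i; rewrite mem_filter mem_generators_below andb_idr// => iX.
by rewrite ltnS (big_rem i iX)/= leq_maxl.
Qed.

Lemma esum_gen_sum f S : (forall i, 0 <= f i) ->
  \sum_(i <- generators_below n N) f i @[N --> \oo] --> S ->
  \esum_(i in setT) (f i)%:E = S%:E.
Proof.
move=> f0 fS; apply/eqP; rewrite eq_le; apply/andP; split.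
  by apply: esum_le_bound => //; exact: partial_gen_sum_le_lim.
have : (\esum_(i in setT) (f i)%:E <= S%:E)%E.
  by apply: esum_le_bound => //; exact: partial_gen_sum_le_lim.
have : (0 <= \esum_(i in setT) (f i)%:E)%E.
  by apply: esum_ge0 => i _; rewrite lee_fin.
have := fun N => partial_le_esum N f0.
case: (\esum_(i in setT) (f i)%:E)%E => // s fs _ _.
by rewrite lee_fin; apply: lim_le_bound fS _ => N; rewrite -lee_fin.
Qed.

End generator_sums.

(** * The transfer operator and its invariant forms *)

(** An ultrafilter that does not contain the preimage of a neighborhood contains
    the preimage of its complement, so a cluster point is a limit. *)
Lemma ultra_cvg_compact (I : Type) (T : topologicalType) (U : set_system I)
    (A : set T) (f : I -> T) : UltraFilter U -> compact A ->
  (forall i, A (f i)) -> exists2 l, A l & f @ U --> l.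
Proof.
move=> UU cA Af.
have UA : U (f @^-1` A) by apply: filterS filterT => i _; exact: Af.
have [l [Al cl]] := cA (f @ U) _ UA.
exists l => // V lV; have [//|UV] := in_ultra_setVsetC (f @^-1` V) UU.
by have [y [nVy Vy]] := cl (~` V) V UV lV.
Qed.

Section transfer.
Context {R : realType} {n : option nat} {H : hilbertType R}.
Variables (B : generator n -> {linear H -> H}) (K : R).
Local Notation gens N := (generators_below n N).
Hypothesis BK :
  forall h N, \sum_(i <- gens N) hnorm (B i h) ^+ 2 <= K * hnorm h ^+ 2.

Definition transfer (q : H -> R) (h : H) : R := gen_sum (fun i => q (B i h)).

(** The forms on which [transfer] is given by convergent sums. *)
Definition bounded_form (q : H -> R) : Prop :=
  [/\ quadratic_form q, forall h, 0 <= q h &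
      exists2 C, 0 <= C & forall h, q h <= C * hnorm h ^+ 2].

Lemma bounded_form_cvg q h : bounded_form q ->
  \sum_(i <- gens N) q (B i h) @[N --> \oo] --> transfer q h.
Proof.
move=> [qq q0 [C C0 qC]].
apply: (@gen_sum_cvg _ _ _ (C * (K * hnorm h ^+ 2))) => // N.
apply: (@le_trans _ _ (\sum_(i <- gens N) C * hnorm (B i h) ^+ 2)).
  by apply: ler_sum => i _; exact: qC.
by rewrite -mulr_sumr ler_wpM2l.
Qed.

Lemma partial_le_transfer q h N : bounded_form q ->
  \sum_(i <- gens N) q (B i h) <= transfer q h.
Proof.
move=> bq; have [_ q0 _] := bq; apply: partial_gen_sum_le_lim => //.
exact: bounded_form_cvg.
Qed.

Lemma transfer_le_bound q h S : bounded_form q ->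
  (forall N, \sum_(i <- gens N) q (B i h) <= S) -> transfer q h <= S.
Proof. by move=> bq; apply: lim_le_bound; exact: bounded_form_cvg. Qed.

Lemma bounded_form_transfer q : bounded_form q -> bounded_form (transfer q).
Proof.
move=> bq; have [qq q0 [C C0 qC]] := bq; split.
- apply: (quadratic_form_cvg (F := \oo)
      (p := fun N h => \sum_(i <- gens N) q (B i h))) => [N|h].
    by apply: quadratic_form_sum => i; exact: quadratic_form_comp.
  exact: bounded_form_cvg.
- move=> h; apply: le_trans (partial_le_transfer h 0 bq).
  exact: sumr_ge0.
- (* K can be negative when H is trivial. *)
  exists (C * Num.max K 0) => [|h].
    by rewrite mulr_ge0// le_max lexx orbT.
  apply: transfer_le_bound => // N.
  apply: (@le_trans _ _ (\sum_(i <- gens N) C * hnorm (B i h) ^+ 2)).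
    by apply: ler_sum => i _; exact: qC.
  rewrite -mulr_sumr -mulrA ler_wpM2l// (le_trans (BK h N))//.
  by rewrite ler_wpM2r ?sqr_ge0// le_max lexx.
Qed.

Lemma transfer_le p q h : bounded_form p -> bounded_form q ->
  (forall x, p x <= q x) -> transfer p h <= transfer q h.
Proof.
move=> bp bq pq; apply: transfer_le_bound => // N.
by apply: le_trans (partial_le_transfer h N bq); apply: ler_sum.
Qed.

Lemma transferZ_le c p q h : bounded_form p -> bounded_form q ->
  (forall x, c * p x <= q x) -> c * transfer p h <= transfer q h.
Proof.
move=> bp bq pq.
have cv : c * \sum_(i <- gens N) p (B i h) @[N --> \oo] --> c * transfer p h.
  by apply: cvgMr; exact: bounded_form_cvg.
apply: (lim_le_bound cv) => N; apply: le_trans (partial_le_transfer h N bq).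
by rewrite mulr_sumr; apply: ler_sum.
Qed.

Lemma bounded_form_hnorm : bounded_form (fun h => hnorm h ^+ 2).
Proof.
split; [exact: quadratic_form_hnorm|by move=> h; exact: sqr_ge0|].
by exists 1 => // h; rewrite mul1r.
Qed.

Lemma bounded_form_iter k q :
  bounded_form q -> bounded_form (iter k transfer q).
Proof. by elim: k => //= k IH /IH; exact: bounded_form_transfer. Qed.

Lemma bounded_form_le p q : quadratic_form p -> bounded_form q ->
  (forall h, 0 <= p h <= q h) -> bounded_form p.
Proof.
move=> qp [_ _ [C C0 qC]] pq; split => [//|h|]; first by have /andP[] := pq h.
by exists C => // h; have /andP[_ /le_trans] := pq h; apply.
Qed.

Local Notation sqn := (fun h : H => hnorm h ^+ 2).

Section means.
Variables (c C : R).
Hypothesis c0 : 0 < c.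
Hypothesis iterC : forall k h, iter k.+1 transfer sqn h <= C * hnorm h ^+ 2.
Hypothesis iterc : forall k h, c * hnorm h ^+ 2 <= iter k.+1 transfer sqn h.

Definition cesaro m h : R :=
  m.+1%:R^-1 * \sum_(0 <= k < m.+1) iter k.+1 transfer sqn h.

Let sqn_iter k : bounded_form (iter k transfer sqn).
Proof. exact/bounded_form_iter/bounded_form_hnorm. Qed.

Lemma cesaro_quadratic m : quadratic_form (cesaro m).
Proof.
apply: quadratic_formZ; apply: quadratic_form_sum => k.
by have [] := sqn_iter k.+1.
Qed.

Lemma cesaro_bounds m h :
  c * hnorm h ^+ 2 <= cesaro m h <= C * hnorm h ^+ 2.
Proof.
have mean (x : R) : x = m.+1%:R^-1 * \sum_(0 <= k < m.+1) x.
  rewrite big_const_nat subn0 iter_addr addr0 -[x *+ _]mulr_natl.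
  by rewrite mulKf ?pnatr_eq0.
have m0 : 0 <= m.+1%:R^-1 :> R by rewrite invr_ge0.
by rewrite /cesaro [c * _]mean [C * _]mean !ler_wpM2l ?ler_sum.
Qed.

(** [transfer] shifts the average by one step, so only the last iterate, which
    is bounded, is new.  The bound is for partial sums, which are finite and hence
    commute with ultrafilter limits. *)
Lemma cesaro_superinvariant m h N :
  \sum_(i <- gens N) cesaro m (B i h) <=
  cesaro m h + m.+1%:R^-1 * (C * hnorm h ^+ 2).
Proof.
have m0 : 0 <= m.+1%:R^-1 :> R by rewrite invr_ge0.
rewrite /cesaro -mulr_sumr -mulrDr ler_wpM2l// exchange_big/=.
apply: (@le_trans _ _ (\sum_(0 <= k < m.+1) iter k.+2 transfer sqn h)).
  by apply: ler_sum => k _; apply: (partial_le_transfer h N (sqn_iter k.+1)).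
rewrite -(big_add1 _ _ 0 m.+2 xpredT (fun k => iter k.+1 transfer sqn h)).
rewrite big_nat_recr//= [in leRHS]big_ltn//.
have /= := iterC m.+1 h; have [_ /(_ h) /= + _] := sqn_iter 1.
by move: (\sum_(1 <= i < _) _) => s; lra.
Qed.

Lemma cvg_partial_sum (F : set_system nat) (FF : Filter F) (p : nat -> H -> R)
    (q : H -> R) (r : seq (generator n)) h :
  (forall x, p m x @[m --> F] --> q x) ->
  \sum_(i <- r) p m (B i h) @[m --> F] --> \sum_(i <- r) q (B i h).
Proof.
move=> pq; elim: r => [|i r IH].
  rewrite big_nil (_ : (fun m => _) = fun=> 0); first exact: cvg_cst.
  by apply/funext => m; rewrite big_nil.
rewrite big_cons (_ : (fun m => _) =
   (fun m => p m (B i h) + \sum_(j <- r) p m (B j h))); first exact: cvgD.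
by apply/funext => m; rewrite big_cons.
Qed.

(** The Cesaro means are pointwise in a compact interval, so they converge
    along an ultrafilter; the limit inherits the inequality for partial sums, as
    the error term tends to 0. *)
Lemma superinvariant_form : exists q : H -> R,
  [/\ quadratic_form q,
      forall h, c * hnorm h ^+ 2 <= q h <= C * hnorm h ^+ 2 &
      forall h, transfer q h <= q h].
Proof.
have [U [UU ooU]] := ultraFilterLemma eventually_filter.
have PU : ProperFilter U by exact: ultra_proper.
have /choice[q qP] : forall h, exists l : R,
    `[c * hnorm h ^+ 2, C * hnorm h ^+ 2]%classic l /\
    cesaro m h @[m --> U] --> l.
  move=> h; have [||l] := @ultra_cvg_compact nat R U
    `[c * hnorm h ^+ 2, C * hnorm h ^+ 2]%classic (cesaro^~ h) UU.
  - exact: segment_compact.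
  - by move=> m; rewrite /= in_itv/=; exact: cesaro_bounds.
  by exists l.
have qq : quadratic_form q.
  apply: (quadratic_form_cvg PU cesaro_quadratic) => h.
  by have [_] := qP h.
have qb h : c * hnorm h ^+ 2 <= q h <= C * hnorm h ^+ 2.
  by have [] := qP h; rewrite /= in_itv.
have C0 : 0 <= Num.max C 0 by rewrite le_max lexx orbT.
have bq : bounded_form q.
  split=> // [h|].
    have /andP[+ _] := qb h; apply: le_trans.
    by rewrite mulr_ge0 ?sqr_ge0// ltW.
  exists (Num.max C 0) => // h; have /andP[_ /le_trans] := qb h; apply.
  by rewrite ler_wpM2r ?sqr_ge0// le_max lexx.
exists q; split=> // h; apply: transfer_le_bound => // N.
have cl : \sum_(i <- gens N) cesaro m (B i h) @[m --> U] -->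
    \sum_(i <- gens N) q (B i h).
  by apply: cvg_partial_sum => x; have [_] := qP x.
have cr : cesaro m h + m.+1%:R^-1 * (C * hnorm h ^+ 2) @[m --> U] --> q h.
  rewrite -[X in _ --> X]addr0 -[X in _ --> _ + X](mul0r (C * hnorm h ^+ 2)).
  apply: cvgD; first by have [_] := qP h.
  apply: cvgMl.
  have : (m.+1%:R^-1 : R) @[m --> \oo] --> 0 by exact: cvg_harmonic.
  by move=> h0 A /h0; exact: ooU.
apply: (ler_cvg_to cl cr); apply: nearW => m; exact: cesaro_superinvariant.
Qed.

(** The iterates [qm] of [transfer] on a superinvariant form [q0] decrease to a
    form [q].  Monotony gives transfer q <= q.  For the converse, the nonnegative
    differences q0 - qm m increase to q0 - q, and each of their partial sums is
    at most transfer q0 - q; letting first m and then the number of generators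
    tend to infinity exchanges the limit with the sum. *)
Lemma invariant_form : exists q : H -> R,
  [/\ quadratic_form q,
      forall h, c ^+ 2 * hnorm h ^+ 2 <= q h <= C * hnorm h ^+ 2 &
      forall h, \sum_(i <- gens N) q (B i h) @[N --> \oo] --> q h].
Proof.
have [q0 [q0q q0b q0S]] := superinvariant_form.
have cn_ge0 h : 0 <= c * hnorm h ^+ 2 by rewrite mulr_ge0 ?sqr_ge0// ltW.
have bq0 : bounded_form q0.
  split=> // [h|]; first by have /andP[+ _] := q0b h; apply: le_trans.
  exists (Num.max C 0) => [|h]; first by rewrite le_max lexx orbT.
  have /andP[_ /le_trans] := q0b h; apply.
  by rewrite ler_wpM2r ?sqr_ge0// le_max lexx.
pose qm m := iter m transfer q0.
have bqm m : bounded_form (qm m) by exact: bounded_form_iter.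
have qmS m h : qm m.+1 h <= qm m h.
  elim: m h => [|m IH] h; first exact: q0S.
  exact: (transfer_le h (bqm m.+1) (bqm m) IH).
have qm_homo h : {homo qm^~ h : m m' / (m <= m')%N >-> m' <= m}.
  move=> m m' /subnK <-; elim: (m' - m)%N => [|k IH]; first exact: lexx.
  exact: le_trans (qmS _ _) IH.
have qm_ge m h : c ^+ 2 * hnorm h ^+ 2 <= qm m h.
  suff : c ^+ 2 * hnorm h ^+ 2 <= qm m.+1 h by move=> /le_trans; apply.
  rewrite expr2 -mulrA; apply: (@le_trans _ _ (c * iter m.+1 transfer sqn h)).
    by rewrite ler_wpM2l// ltW.
  elim: m.+1 h => [|k IH] h /=; first by have /andP[] := q0b h.
  by apply: transferZ_le; [exact: sqn_iter|exact: bqm|exact: IH].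
pose q h := limn (qm^~ h).
have qmq h : qm m h @[m --> \oo] --> q h.
  apply: nonincreasing_is_cvgn; first exact: qm_homo.
  by exists (c ^+ 2 * hnorm h ^+ 2) => _ [m _ <-]; exact: qm_ge.
have q_le m h : q h <= qm m h.
  by apply: nonincreasing_cvgn_ge; [exact: qm_homo|apply/cvg_ex; exists (q h)].
have q_lim h S : (forall m, S <= qm m h) -> S <= q h.
  by move=> Sq; apply: limr_ge; [apply/cvg_ex; exists (q h)|exact: nearW].
have q_ge h : c ^+ 2 * hnorm h ^+ 2 <= q h by exact: q_lim.
have qq : quadratic_form q.
  by apply: (quadratic_form_cvg _ _ qmq) => m; have [] := bqm m.
have bq : bounded_form q.
  apply: (bounded_form_le qq bq0) => h; rewrite (q_le 0) andbT.
  by apply: le_trans (q_ge h); rewrite mulr_ge0 ?sqr_ge0.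
exists q; split=> // h.
  by rewrite q_ge/= (le_trans (q_le 0 h))//; have /andP[] := q0b h.
suff <- : transfer q h = q h by exact: bounded_form_cvg.
apply/eqP; rewrite eq_le; apply/andP; split.
  apply: q_lim => m; apply: le_trans (qmS m h).
  exact: (transfer_le h bq (bqm m)).
have diff_le m N : \sum_(i <- gens N) (q0 (B i h) - qm m (B i h)) <=
    transfer q0 h - q h.
  apply: (@le_trans _ _ (transfer q0 h - qm m.+1 h)); last by rewrite lerB.
  apply: (partial_gen_sum_le_lim (f := fun i => q0 (B i h) - qm m (B i h))).
    by move=> i; rewrite subr_ge0 (qm_homo _ 0).
  rewrite (_ : (fun N => _) = (fun N => \sum_(i <- gens N) q0 (B i h) -
      \sum_(i <- gens N) qm m (B i h))); last first.
    by apply/funext => k; rewrite sumrB.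
  by apply: cvgB; apply: bounded_form_cvg.
have lim_diff_le N :
  \sum_(i <- gens N) q0 (B i h) - \sum_(i <- gens N) q (B i h) <=
    transfer q0 h - q h.
  have cv : \sum_(i <- gens N) q0 (B i h) - \sum_(i <- gens N) qm m (B i h)
      @[m --> \oo] -->
    \sum_(i <- gens N) q0 (B i h) - \sum_(i <- gens N) q (B i h).
    by apply: cvgB; [exact: cvg_cst|exact: cvg_partial_sum].
  by apply: (lim_le_bound cv) => m; rewrite -sumrB diff_le.
have : transfer q0 h - transfer q h <= transfer q0 h - q h.
  by apply: lim_le_bound lim_diff_le; apply: cvgB; apply: bounded_form_cvg.
by rewrite lerD2l lerN2.
Qed.

End means.

End transfer.

(** * Level sums and Cuntz row isometries *)

Section adjoints_of_words.
Context {R : realType}.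

Lemma is_adjoint_uniq (H K : hilbertType R) (A : H -> K) (B B' : K -> H) :
  is_adjoint A B -> is_adjoint A B' -> B = B'.
Proof. by move=> /adjoint_unique <- /adjoint_unique. Qed.

Lemma is_adjoint_id (H : hilbertType R) : is_adjoint (@id H) id.
Proof. by []. Qed.

Lemma is_adjoint_ip (H K : hilbertType R) (A : H -> K) (B : K -> H) x y :
  is_adjoint A B -> ip (A x) y = ip x (B y).
Proof. by move=> AB; rewrite /ip AB. Qed.

Lemma is_adjointZ (H K : hilbertType R) (A : H -> K) (B : K -> H) (t : R) y :
  is_adjoint A B -> B (t%:C *: y) = t%:C *: B y.
Proof.
move=> AB; apply: ip_inj => x.
by rewrite -(is_adjoint_ip _ _ AB) !ipZr (is_adjoint_ip _ _ AB).
Qed.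

Lemma cvg_ip (H : hilbertType R) (z l : H) (u : nat -> H) :
  u N @[N --> \oo] --> l -> ip z (u N) @[N --> \oo] --> ip z l.
Proof.
move=> /cvg_hnormP ul; apply/cvgrPdist_lt => e e0.
have d0 : 0 < e / (hnorm z + 1) by rewrite divr_gt0// ltr_wpDl ?hnorm_ge0.
have := ul _ d0; apply: filterS => N.
rewrite ltr_pdivlMr ?ltr_wpDl ?hnorm_ge0// => h; rewrite -ipBr.
apply: le_lt_trans (normr_ip_le _ _) _; apply: le_lt_trans h.
by rewrite mulrC ler_wpM2l ?hnorm_ge0// lerDl.
Qed.

Lemma cvg_bounded_operator (H K : hilbertType R) (A : {linear H -> K})
    (u : nat -> H) l :
  bounded_operator A -> u N @[N --> \oo] --> l -> A (u N) @[N --> \oo] --> A l.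
Proof.
by move=> /bounded_linear_continuous Ac ul; exact: (cvg_comp _ _ ul (Ac l)).
Qed.

Section words.
Context {n : option nat} {H : hilbertType R}.
Variable T : generator n -> {linear H -> H}.
Hypothesis hT : forall i, bounded_operator (T i).

Lemma word_adjointP w : is_adjoint (word_op T w) (adjoint (word_op T w)).
Proof.
suff [B TB] : exists B, is_adjoint (word_op T w) B.
  by rewrite (adjoint_unique TB).
elim: w => [|i w [B TB]]; first by exists id.
exists (B \o adjoint (T i)); exact: is_adjoint_comp TB (adjointP (hT i)).
Qed.

Lemma adjoint_word_cons i w :
  adjoint (word_op T (i :: w)) = adjoint (word_op T w) \o adjoint (T i).
Proof.
apply: adjoint_unique.
exact: (is_adjoint_comp (word_adjointP w) (adjointP (hT i))).
Qed.

Lemma level_sum0 h : level_sum T 0 h = (hnorm h ^+ 2)%:E.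
Proof.
rewrite /level_sum (_ : words 0 = [set [::]]); last first.
  by apply/seteqP; split => [[]|_ ->].
rewrite esum_set1 ?lee_fin ?sqr_ge0//=.
by rewrite (adjoint_unique (@is_adjoint_id H)).
Qed.

(** The first letter of a word acts last in [word_op], hence first in its
    adjoint. *)
Lemma level_sumS k h :
  level_sum T k.+1 h = \esum_(i in setT) level_sum T k (adjoint (T i) h).
Proof.
rewrite /level_sum esum_esum; last by move=> *; rewrite lee_fin sqr_ge0.
rewrite (reindex_esum ([set: generator n] `*`` (fun=> words k)) _
  (fun iw => iw.1 :: iw.2)).
  by apply: eq_esum => -[i w] _ /=; rewrite adjoint_word_cons.
split.
- by move=> [i w] [_ /= <-].
- by move=> [i w] [j v] _ _ /= [-> ->].
- by case=> [|i w]//= [wk]; exists (i, w).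
Qed.

End words.

Lemma similar_word n (H W : hilbertType R) (T : generator n -> {linear H -> H})
   (V : generator n -> {linear W -> W}) (S : H -> W) w x :
  (forall i h, S (T i h) = V i (S h)) -> S (word_op T w x) = word_op V w (S x).
Proof. by move=> ST; elim: w => //= i w IH; rewrite ST IH. Qed.

(** The partial sums P_N of sum_i V_i D_i are positive contractions, so that
    P_N^2 <= P_N; this is the nonnegativity of sum_i |D_i (P_N x - x)|^2 over the
    first generators.  Hence |x - P_N x|^2 <= |x|^2 - sum_i |D_i x|^2. *)
Lemma coisometry_partial_sum n (W : hilbertType R)
    (V D : generator n -> {linear W -> W}) :
  (forall i, is_adjoint (V i) (D i)) ->
  (forall x, \sum_(i <- generators_below n N) hnorm (D i x) ^+ 2 @[N --> \oo]
     --> hnorm x ^+ 2) ->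
  forall x, \sum_(i <- generators_below n N) V i (D i x) @[N --> \oo] --> x.
Proof.
move=> VD Dx x.
pose s N := \sum_(i <- generators_below n N) hnorm (D i x) ^+ 2.
pose P N := \sum_(i <- generators_below n N) V i (D i x).
have Dle N y :
    \sum_(i <- generators_below n N) hnorm (D i y) ^+ 2 <= hnorm y ^+ 2.
  by apply: partial_gen_sum_le_lim (Dx y) N => i; exact: sqr_ge0.
have ipP N y : ip y (P N) = \sum_(i <- generators_below n N) ip (D i y) (D i x).
  rewrite ip_sumr; apply: eq_bigr => i _.
  by rewrite (is_adjoint_ip _ _ (is_adjoint_sym (VD i))).
have PN N : hnorm (P N) ^+ 2 <= s N.
  have : 0 <= \sum_(i <- generators_below n N) hnorm (D i (P N) - D i x) ^+ 2.
    by apply: sumr_ge0 => i _; exact: sqr_ge0.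
  under eq_bigr do rewrite hnormB2.
  rewrite big_split sumrB/= -mulr_sumr -ipP ipxx.
  by have := Dle N (P N); rewrite -/(s N); lra.
have xP N : hnorm (x - P N) ^+ 2 <= hnorm x ^+ 2 - s N.
  rewrite hnormB2 ipP (eq_bigr (fun i => hnorm (D i x) ^+ 2)) => [|i _].
    by have := PN N; rewrite -/(s N); lra.
  exact: ipxx.
apply/cvg_hnormP => e e0.
have e2 : 0 < e ^+ 2 by rewrite exprn_gt0.
have /cvgrPdist_lt/(_ _ e2) := Dx x; apply: filterS => N h.
rewrite -(@ltr_pXn2r _ 2%N)// ?nnegrE ?hnorm_ge0 ?(ltW e0)//.
by apply: le_lt_trans (xP N) _; apply: le_lt_trans h; exact: ler_norm.
Qed.

Lemma cuntz_level_sum n (W : hilbertType R)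
    (V : generator n -> {linear W -> W}) :
  cuntz_row_isometry V -> forall k y, level_sum V k y = (hnorm y ^+ 2)%:E.
Proof.
move=> [hV _ VV]; elim=> [|k IH] y; first exact: level_sum0.
rewrite level_sumS//; under eq_esum do rewrite IH.
apply: esum_gen_sum => [i|]; first exact: sqr_ge0.
have := @cvg_ip _ y _ _ (VV y); rewrite ipxx; apply: cvg_trans.
apply: near_eq_cvg; apply: nearW => N.
rewrite ip_sumr; apply: eq_bigr => i _.
by rewrite -ipxx (is_adjoint_ip _ _ (is_adjoint_sym (adjointP (hV i)))).
Qed.

(** If C1 and C2 bound the adjoints of S and of its inverse, then g, the image of
    h / C2 under the adjoint of the inverse, satisfies |h| / C2 <= C1 |g|, while
    |V_w^* g| <= |T_w^* h| for every word w. *)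
Lemma similar_cuntz_lower_bound n (H W : hilbertType R)
    (T : generator n -> {linear H -> H}) (V : generator n -> {linear W -> W}) :
  (forall i, bounded_operator (T i)) ->
  cuntz_row_isometry V -> jointly_similar T V ->
  exists2 c : R, 0 < c &
    forall h k, ((c * hnorm h ^+ 2)%:E <= level_sum T k h)%E.
Proof.
move=> hT cV [S [S' [[bS bS'] SK S'K ST]]].
have [hV _ _] := cV.
have [Sa SSa /bounded_operatorP[C1 C10 SaC]] := adjoint_ex bS.
have [Sa' SSa' /bounded_operatorP[C2 C20 SaC']] := adjoint_ex bS'.
have SaSa' : Sa \o Sa' = id.
  apply: (is_adjoint_uniq (is_adjoint_comp SSa SSa')).
  by rewrite (_ : S' \o S = id)//; apply/funext => x /=; rewrite SK.
have Sa'Sa : Sa' \o Sa = id.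
  apply: (is_adjoint_uniq (is_adjoint_comp SSa' SSa)).
  by rewrite (_ : S \o S' = id)//; apply/funext => x /=; rewrite S'K.
have Tw w : adjoint (word_op T w) = Sa \o (adjoint (word_op V w) \o Sa').
  apply: adjoint_unique.
  rewrite (_ : word_op T w = S' \o word_op V w \o S).
    exact: is_adjoint_comp SSa (is_adjoint_comp (word_adjointP hV w) SSa').
  by apply/funext => x /=; rewrite -(similar_word _ _ ST) SK.
exists ((C1 * C2)^-1 ^+ 2) => [|h k].
  by rewrite exprn_gt0// invr_gt0 mulr_gt0.
pose g := Sa' ((C2^-1)%:C *: h).
apply: (@le_trans _ _ (level_sum V k g)).
  rewrite cuntz_level_sum// lee_fin -exprMn.
  rewrite ler_pXn2r// ?nnegrE ?hnorm_ge0//; last first.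
    by rewrite mulr_ge0 ?hnorm_ge0// invr_ge0 mulr_ge0 ?ltW.
  have := SaC g; rewrite -[Sa g]/((Sa \o Sa') _) SaSa'.
  rewrite hnormZ gtr0_norm ?invr_gt0//.
  by rewrite invfM -mulrA -ler_pdivrMl.
apply: le_esum => w _; rewrite lee_fin ler_pXn2r// ?nnegrE ?hnorm_ge0//.
have := SaC' (Sa (adjoint (word_op V w) g)).
rewrite -[Sa' (Sa _)]/((Sa' \o Sa) _) Sa'Sa => /le_trans; apply.
have -> : Sa (adjoint (word_op V w) g) =
    adjoint (word_op T w) ((C2^-1)%:C *: h).
  by rewrite Tw.
rewrite (is_adjointZ _ _ (word_adjointP hT w)) hnormZ gtr0_norm ?invr_gt0//.
by rewrite mulVKf ?gt_eqF.
Qed.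

End adjoints_of_words.

(** * Construction of the Cuntz row isometry *)

Section construction.
Context {R : realType} {n : option nat} {H : hilbertType R}.
Variable T : generator n -> {linear H -> H}.
Hypothesis hT : forall i, bounded_operator (T i).
Local Notation gens N := (generators_below n N).

Lemma bounded_operator_comp (H1 H2 H3 : hilbertType R) (A : {linear H1 -> H2})
    (B : {linear H2 -> H3}) :
  bounded_operator A -> bounded_operator B -> bounded_operator (B \o A).
Proof.
move=> /bounded_operatorP[a a0 Aa] /bounded_operatorP[b b0 Bb].
apply/bounded_operatorP; exists (b * a) => [|x]; first exact: mulr_gt0.
by apply: le_trans (Bb _) _; rewrite -mulrA ler_wpM2l// ltW.
Qed.

Lemma level_sum_transfer (B : generator n -> {linear H -> H}) K :
  (forall i, adjoint (T i) = B i) ->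
  (forall h N, \sum_(i <- gens N) hnorm (B i h) ^+ 2 <= K * hnorm h ^+ 2) ->
  forall k h, level_sum T k h =
    (iter k (transfer B) (fun h => hnorm h ^+ 2) h)%:E.
Proof.
move=> TB BK; elim=> [|k IH] h; first exact: level_sum0.
rewrite level_sumS//; under eq_esum do rewrite TB IH.
have bk := bounded_form_iter BK k bounded_form_hnorm.
apply: esum_gen_sum => [i|]; first by have [_ + _] := bk; apply.
exact: (bounded_form_cvg BK bk).
Qed.

(** With x = V_j w, the families (V_i^* x)_i and (w in position j, 0 elsewhere)
    are both mapped to x by the row operator of V, because sum_i V_i V_i^* = 1.
    Carried to H by [S'], they are mapped to S' x by that of T, hence they are
    equal, and their j-th entries give V_j^* V_j w = w. *)
Lemma injective_row_isometry (W : hilbertType R)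
    (V D : generator n -> {linear W -> W}) (S' : {linear W -> H}) :
  one_to_one T -> bounded_operator S' -> injective S' ->
  (forall i w, S' (V i w) = T i (S' w)) ->
  (forall i, is_adjoint (V i) (D i)) ->
  (forall x, \sum_(i <- gens N) hnorm (D i x) ^+ 2 @[N --> \oo]
     --> hnorm x ^+ 2) ->
  forall j w, hnorm (V j w) = hnorm w.
Proof.
move=> Tinj bS' S'inj S'V VD Dx j w.
have /bounded_operatorP[C C0 S'C] := bS'.
pose x := V j w.
pose a i := S' (D i x).
pose b i := if i == j then S' w else 0.
have aT : direct_sum a.
  apply: (@le_lt_trans _ _ (C ^+ 2 * hnorm x ^+ 2)%:E); last exact: ltry.
  apply: esum_le_bound => [i|N]; first exact: sqr_ge0.
  apply: (@le_trans _ _ (\sum_(i <- gens N) C ^+ 2 * hnorm (D i x) ^+ 2)).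
    apply: ler_sum => i _; rewrite -exprMn ler_pXn2r// ?nnegrE ?hnorm_ge0//.
      exact: S'C.
    by rewrite mulr_ge0 ?hnorm_ge0// ltW.
  rewrite -mulr_sumr ler_wpM2l ?sqr_ge0//.
  by apply: partial_gen_sum_le_lim (Dx x) N => i; exact: sqr_ge0.
have bT : direct_sum b.
  rewrite /direct_sum /= (eq_esum (b := fun i => if i \in [set j]
     then (hnorm (S' w) ^+ 2)%:E else 0%E)) => [|i _].
    by rewrite -esum_mkcond esum_set1 ?ltry// lee_fin sqr_ge0.
  rewrite /b; case: (eqVneq i j) => [->|ij]; first by rewrite mem_set.
  rewrite memNset ?hnorm0 ?expr0n//= => ij'; by rewrite ij' eqxx in ij.
have Ta : row_operator T a = S' x.
  apply: (cvg_lim (@norm_hausdorff _ H)).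
  have := cvg_bounded_operator bS' (coisometry_partial_sum VD Dx (x := x)).
  apply: cvg_trans; apply: near_eq_cvg; apply: nearW => N.
  by rewrite linear_sum; apply: eq_bigr => i _; rewrite /a S'V.
have Tb : row_operator T b = S' x.
  apply: (cvg_lim (@norm_hausdorff _ H)).
  apply: cvg_near_cst; exists (val j).+1 => // N /= jN.
  rewrite (bigD1_seq j) ?mem_generators_below ?generators_below_uniq//=.
  rewrite big1 => [|i /negPf ij]; last by rewrite /b ij linear0.
  by rewrite addr0 /b eqxx -S'V.
have /(congr1 (fun f => f j)) : a = b.
  by apply: Tinj; rewrite ?inE// Ta Tb.
rewrite /a /b eqxx => /S'inj Dw.
apply/eqP; rewrite -(@eqrXn2 _ 2%N) ?hnorm_ge0//; apply/eqP.
by rewrite -!ipxx (is_adjoint_ip _ _ (VD j)) -/x Dw.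
Qed.

(** The similarity is the adjoint S of the identity J from the renormed space to
    H: J intertwines D_i with the adjoint of T_i, so S intertwines T_i with the
    adjoint V_i of D_i. *)
Lemma cuntz_of_lower_bound (M c : R) : one_to_one T -> 0 < M -> 0 < c ->
  (forall h k, (0 < k)%N ->
     (level_sum T k h <= (M ^+ 2 * hnorm h ^+ 2)%:E)%E) ->
  (forall h k, (0 < k)%N -> ((c * hnorm h ^+ 2)%:E <= level_sum T k h)%E) ->
  exists (W : hilbertType R) (V : generator n -> {linear W -> W}),
      cuntz_row_isometry V /\ jointly_similar T V.
Proof.
move=> Tinj M0 c0 TM Tc.
have /choice[B] : forall i, exists B : {linear H -> H},
    is_adjoint (T i) B /\ bounded_operator B.
  by move=> i; have [B TB bB] := adjoint_ex (hT i); exists B.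
move=> /all_and2[TB bB].
have aTB i : adjoint (T i) = B i by exact: adjoint_unique.
have BM h N : \sum_(i <- gens N) hnorm (B i h) ^+ 2 <= M ^+ 2 * hnorm h ^+ 2.
  rewrite -lee_fin; apply: le_trans (TM h 1 isT); rewrite level_sumS//.
  under eq_esum do rewrite level_sum0 aTB.
  by apply: partial_le_esum => i; exact: sqr_ge0.
have lE := level_sum_transfer aTB BM.
have [||q [qq qb qB]] := invariant_form BM c0 (C := M ^+ 2).
- by move=> k h; rewrite -lee_fin -lE TM.
- by move=> k h; rewrite -lee_fin -lE Tc.
have low : exists2 a, 0 < a & forall x, a * hnorm x ^+ 2 <= q x.
  by exists (c ^+ 2) => [|h]; [rewrite exprn_gt0|have /andP[] := qb h].
have up : exists2 a, 0 < a & forall x, q x <= a * hnorm x ^+ 2.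
  by exists (M ^+ 2) => [|h]; [rewrite exprn_gt0|have /andP[] := qb h].
pose Q := EquivalentForm qq low up.
pose W : hilbertType R := renormed Q.
have WE (x : W) : hnorm x ^+ 2 = q x := renormed_hnorm2 x.
pose J : {linear W -> H} := (idfun : {linear H -> H}).
pose J' : {linear H -> W} := (idfun : {linear H -> H}).
have bJ : bounded_operator J.
  have [a a0 aq] := low; apply/bounded_operatorP.
  exists (Num.sqrt a)^-1 => [|x]; first by rewrite invr_gt0 sqrtr_gt0.
  rewrite ler_pdivlMl ?sqrtr_gt0// -(@ler_pXn2r _ 2%N)//
    ?nnegrE ?mulr_ge0 ?sqrtr_ge0 ?hnorm_ge0//.
  by rewrite exprMn sqr_sqrtr ?(ltW a0)// WE; exact: aq.
have bJ' : bounded_operator J'.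
  have [a a0 aq] := up; apply/bounded_operatorP.
  exists (Num.sqrt a) => [|x]; first by rewrite sqrtr_gt0.
  rewrite -(@ler_pXn2r _ 2%N)// ?nnegrE ?mulr_ge0 ?sqrtr_ge0 ?hnorm_ge0//.
  by rewrite WE exprMn sqr_sqrtr ?(ltW a0)//; exact: aq.
pose D i : {linear W -> W} := J' \o (B i \o J).
have bD i : bounded_operator (D i).
  exact: (bounded_operator_comp (bounded_operator_comp bJ (bB i)) bJ').
have [S JS bS] := adjoint_ex bJ.
have [S' JS' bS'] := adjoint_ex bJ'.
have /choice[V] : forall i, exists V : {linear W -> W},
    is_adjoint (D i) V /\ bounded_operator V.
  by move=> i; have [V DV bV] := adjoint_ex (bD i); exists V.
move=> /all_and2[DV bV].
have S'S : S' \o S = id.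
  by apply: (is_adjoint_uniq (is_adjoint_comp JS' JS)).
have SS' : S \o S' = id.
  by apply: (is_adjoint_uniq (is_adjoint_comp JS JS')).
have SK x : S' (S x) = x by rewrite -[LHS]/((S' \o S) x) S'S.
have S'K x : S (S' x) = x by rewrite -[LHS]/((S \o S') x) SS'.
have ST i h : S (T i h) = V i (S h).
  have : S \o T i = V i \o S.
    apply: (@is_adjoint_uniq _ _ _ (B i \o J)).
      exact: is_adjoint_comp JS (is_adjoint_sym (TB i)).
    exact: (is_adjoint_comp (DV i) JS).
  by move=> /(congr1 (fun f => f h)).
have VD i := is_adjoint_sym (DV i).
have Dx x : \sum_(i <- gens N) hnorm (D i x) ^+ 2 @[N --> \oo] --> hnorm x ^+ 2.
  rewrite WE (_ : (fun N => _) = (fun N => \sum_(i <- gens N) q (B i x))).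
    exact: qB.
  by apply/funext => N; apply: eq_bigr => i _; rewrite WE.
exists W, V; split; last by exists S, S'.
split=> // [j w|x].
  apply: (injective_row_isometry Tinj bS' _ _ VD Dx) => [x y xy|i x].
    by rewrite -(S'K x) xy S'K.
  by rewrite -{1}(S'K x) -ST SK.
rewrite (_ : (fun N => _) = (fun N => \sum_(i <- gens N) V i (D i x))).
  exact: coisometry_partial_sum.
by apply/funext => N; apply: eq_bigr => i _; rewrite (adjoint_unique (VD i)).
Qed.
End construction.

Theorem corollary5p6 (R : realType) (n : option nat) (hn : n <> Some 0%N)
    (H : hilbertType R) (T : generator n -> {linear H -> H})
    (hT : forall i, bounded_operator (T i))
    (T_inj : one_to_one T) (T_pb : power_bounded T) :
  (exists (W : hilbertType R) (V : generator n -> {linear W -> W}),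
      cuntz_row_isometry V /\ jointly_similar T V) <->
  (exists2 c : R, 0 < c & forall (h : H) (k : nat), (0 < k)%N ->
      ((c * hnorm h ^+ 2)%:E <= level_sum T k h)%E).
Proof.
split=> [[W [V [cV TV]]]|[c c0 Tc]].
  have [c c0 Tc] := similar_cuntz_lower_bound hT cV TV.
  by exists c => // h k _; exact: Tc.
have [M M0 TM] := T_pb.
exact: (cuntz_of_lower_bound hT T_inj M0 c0 TM Tc).
Qed.
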